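(* Let $S$ be a subtractive valuation semiring. Then $S$ is 2-AB if and only if $\mathfrak{p}^2=\mathfrak{p}$ for every prime ideal $\mathfrak{p}$ of $S$.
   Context: A semiring is a set $S$ with operations $+,\cdot$ and elements $0\neq 1$ such that $(S,+,0)$ is a commutative monoid, $(S,\cdot,1)$ is a monoid, multiplication distributes over addition on both sides, and $a\cdot 0=0\cdot a=0$ for all $a\in S$. All semirings are assumed commutative (multiplication is commutative). An ideal of $S$ is a nonempty subset $\mathfrak{a}$ closed under addition with $sx\in\mathfrak{a}$ for all $s\in S$, $x\in\mathfrak{a}$; it is proper if $\mathfrak{a}\neq S$. The product of ideals is $IJ=\{\sum_{i=1}^n a_ib_i : a_i\in I,\ b_i\in J,\ n\in\mathbb{N}\}$, and $\mathfrak{p}^2=\mathfrak{p}\mathfrak{p}$. An ideal $\mathfrak{a}$ is subtractive if $x+y\in\mathfrak{a}$ and $x\in\mathfrak{a}$ imply $y\in\mathfrak{a}$ for all $x,y\in S$; $S$ is subtractive if every ideal of $S$ is subtractive. A semidomain is a semiring in which $xy=xz$ and $x\neq 0$ imply $y=z$. A valuation semiring is a semidomain whose ideals are totally ordered by inclusion. A proper ideal $\mathfrak{p}$ is prime if $ab\in\mathfrak{p}$ implies $a\in\mathfrak{p}$ or $b\in\mathfrak{p}$. A proper ideal $\mathfrak{a}$ is 2-absorbing if, for $x,y,z\in S$, $xyz\in\mathfrak{a}$ implies $xy\in\mathfrak{a}$ or $yz\in\mathfrak{a}$ or $xz\in\mathfrak{a}$. $S$ is a 2-AB semiring if every 2-absorbing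 ideal of $S$ is prime. *)

(* Defs.v *)
From mathcomp Require Import all_boot all_algebra.
From mathcomp Require Import classical_sets.

Set Implicit Arguments.
Unset Strict Implicit.
Unset Printing Implicit Defensive.

Import GRing.Theory.
Local Open Scope classical_set_scope.
Local Open Scope ring_scope.

(* Ideals are arbitrary, not necessarily decidable, subsets: the ideals of
   mathcomp's ring_quotient are boolean predicates on rings with subtraction.
   Equality of ideals is equality in [set S], which is extensional. *)

Section Ideals.

Variable S : comNzSemiRingType.
Implicit Types I J : set S.

Definition is_ideal I : Prop :=
  [/\ I !=set0,
      forall x y, I x -> I y -> I (x + y)
    & forall s x, I x -> I (s * x)].

Definition proper_ideal I : Prop := is_ideal I /\ I <> setT.

Definition ideal_mul I J : set S :=
  [set x | exists (n : nat) (a b : 'I_n -> S),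
     [/\ forall i, I (a i), forall i, J (b i) & x = \sum_(i < n) a i * b i]].

Definition subtractive_ideal I : Prop :=
  is_ideal I /\ forall x y, I (x + y) -> I x -> I y.

Definition prime_ideal I : Prop :=
  proper_ideal I /\ forall a b, I (a * b) -> I a \/ I b.

Definition two_absorbing_ideal I : Prop :=
  proper_ideal I /\
  forall x y z, I (x * y * z) -> [\/ I (x * y), I (y * z) | I (x * z)].

End Ideals.

Definition subtractive_semiring (S : comNzSemiRingType) : Prop :=
  forall I : set S, is_ideal I -> subtractive_ideal I.

Definition semidomain (S : comNzSemiRingType) : Prop :=
  forall x y z : S, x * y = x * z -> x <> 0 -> y = z.

Definition valuation_semiring (S : comNzSemiRingType) : Prop :=
  semidomain S /\
  forall I J : set S, is_ideal I -> is_ideal J -> I `<=` J \/ J `<=` I.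

Definition two_AB_semiring (S : comNzSemiRingType) : Prop :=
  forall I : set S, two_absorbing_ideal I -> prime_ideal I.

(* Main.v *)
(* Divisibility is total in a valuation semiring. Hence every element of p^2 is
   a single product ab with a, b in p, and cancelling elements outside p shows
   that p^2 is 2-absorbing whenever p is prime; if it is prime then p^2 = p,
   because a in p gives a * a in p^2.
   Conversely, for a 2-absorbing ideal I the set P = {x | x^2 in I} is a prime
   ideal with P^2 <= I <= P, so that P^2 = P forces I = P. *)
Require Import Defs.
From mathcomp Require Import all_boot all_algebra.
From mathcomp Require Import boolp classical_sets.

Set Implicit Arguments.
Unset Strict Implicit.
Unset Printing Implicit Defensive.

Import GRing.Theory.
Local Open Scope classical_set_scope.
Local Open Scope ring_scope.

Section Ideals.

Variable S : comNzSemiRingType.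
Implicit Types (I J p : set S) (x y z : S).

Lemma ideal_mulr I x s : is_ideal I -> I x -> I (x * s).
Proof. by case=> _ _ hM Ix; rewrite mulrC; apply: hM. Qed.

Lemma ideal0 I : is_ideal I -> I 0.
Proof. by case=> [[x Ix] _ hM]; rewrite -(mul0r x); apply: hM. Qed.

Lemma proper_idealP I : is_ideal I -> (Defs.proper_ideal I <-> ~ I 1).
Proof.
move=> hI; split=> [[_ IT] I1 | I1]; last by split=> // IT; apply: I1; rewrite IT.
apply: IT; apply/seteqP; split=> // x _.
by rewrite -(mul1r x); apply: ideal_mulr.
Qed.

Lemma principal_ideal x : is_ideal [set y | exists c, y = x * c].
Proof.
split=> [|_ _ [c ->] [d ->]|s _ [c ->]].
- by exists x, 1; rewrite mulr1.
- by exists (c + d); rewrite mulrDr.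
- by exists (s * c); rewrite mulrCA.
Qed.

Lemma ideal_mul_prod I J a b : I a -> J b -> ideal_mul I J (a * b).
Proof. by exists 1%N, (fun=> a), (fun=> b); split=> //; rewrite big_ord1. Qed.

Lemma two_absorbing_sqr I x : two_absorbing_ideal I -> I (x * x * x) -> I (x * x).
Proof. by case=> _ /[apply] -[]. Qed.

Hypothesis hval : valuation_semiring S.

(** Compare the principal ideals of [x] and [y]: inclusion of one in the other is divisibility of
    their generators. *)
Lemma valuation_dvd_total x y : (exists c, y = x * c) \/ (exists c, x = y * c).
Proof.
have [_ htot] := hval.
case: (htot _ _ (principal_ideal x) (principal_ideal y)) => h; [right|left];
  by apply: h; exists 1; rewrite mulr1.
Qed.

Lemma ideal_mul_single I J x : is_ideal I -> is_ideal J ->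
  ideal_mul I J x <-> exists a b, [/\ I a, J b & x = a * b].
Proof.
move=> hI hJ; split=> [[n [a [b [Ia Jb ->]]]]|[a [b [Ia Jb ->]]]]; last first.
  exact: ideal_mul_prod.
pose Q y := exists a b, [/\ I a, J b & y = a * b].
apply: (big_ind Q) => [|_ _ [a1 [b1 [I1 J1 ->]]] [a2 [b2 [I2 J2 ->]]]|i _].
- by exists 0, 0; split; rewrite ?mul0r //; apply: ideal0.
- have [_ hD hM] := hJ.
  (* Two products merge: whichever of [a1], [a2] divides the other is factored out, and the
     remaining cofactor stays in [J]. *)
  case: (valuation_dvd_total a1 a2) => -[c E].
  + exists a1, (b1 + c * b2); split=> //; first by apply: hD => //; apply: hM.
    by rewrite mulrDr mulrA -E.
  + exists a2, (c * b1 + b2); split=> //; first by apply: hD => //; apply: hM.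
    by rewrite mulrDr mulrA -E.
- by exists (a i), (b i).
Qed.

Lemma ideal_mul_ideal I J : is_ideal I -> is_ideal J -> is_ideal (ideal_mul I J).
Proof.
move=> hI hJ; split=> [|x y|s x].
- by exists (0 * 0); apply: ideal_mul_prod; apply: ideal0.
- have [_ _ hMI] := hI; have [_ hD hM] := hJ.
  case/(ideal_mul_single _ hI hJ)=> a [b [Ia Jb ->]].
  case/(ideal_mul_single _ hI hJ)=> c [d [Ic Jd ->]].
  case: (valuation_dvd_total a c) => -[e ->].
  + by rewrite -mulrA -mulrDr; apply: ideal_mul_prod => //; apply: hD => //; apply: hM.
  + by rewrite -mulrA -mulrDr; apply: ideal_mul_prod => //; apply: hD => //; apply: hM.
- case/(ideal_mul_single _ hI hJ)=> a [b [Ia Jb ->]]; have [_ _ hM] := hI.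
  by rewrite mulrA; apply: ideal_mul_prod => //; apply: hM.
Qed.

(** Write [x * s = a * b] with [a], [b] in [p]. As [s] is outside [p], [a] cannot divide it, so
    [a = s * c]; primality puts [c] in [p], and cancelling [s] gives [x = c * b]. *)
Lemma prime_sqr_cancel p x s : prime_ideal p -> ~ p s ->
  ideal_mul p p (x * s) -> ideal_mul p p x.
Proof.
move=> [[hp _] hpr] ps /(ideal_mul_single _ hp hp)[a [b [pa pb E]]].
case: (valuation_dvd_total a s) => -[c Ec].
  by case: ps; rewrite Ec; apply: ideal_mulr.
have pc : p c by move: pa; rewrite Ec => /hpr[].
have [canc _] := hval.
suff -> : x = c * b by apply: ideal_mul_prod.
apply: (canc s); first by rewrite mulrC E Ec mulrA.
by move=> s0; apply: ps; rewrite s0; apply: ideal0.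
Qed.

Lemma prime_sqr_two_absorbing p :
  prime_ideal p -> two_absorbing_ideal (ideal_mul p p).
Proof.
move=> hp; have [[ip np] hpr] := hp; have hp2 := ideal_mul_ideal ip ip.
have sub x : ideal_mul p p x -> p x.
  by case/(ideal_mul_single _ ip ip)=> a [b [pa _ ->]]; apply: ideal_mulr.
have p1 : ~ p 1 by apply/(proper_idealP ip).
split; first by apply/(proper_idealP hp2) => /sub.
move=> x y z h.
(* Either two factors in [p] multiply into the square of [p], or a factor outside [p] is cancelled
   from [h], leaving the product of the other two. *)
have [px|npx] := pselect (p x); have [py|npy] := pselect (p y).
- by constructor 1; apply: ideal_mul_prod.
- have [pz|npz] := pselect (p z); first by constructor 3; apply: ideal_mul_prod.
  by constructor 1; apply: (prime_sqr_cancel hp npz).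
- by constructor 2; apply: (prime_sqr_cancel hp npx); rewrite mulrC mulrA.
- by constructor 3; apply: (prime_sqr_cancel hp npy); rewrite mulrAC.
Qed.

Lemma two_absorbing_radical_prime I :
  two_absorbing_ideal I -> prime_ideal [set x | I (x * x)].
Proof.
move=> hI; have [[iI nI] hA] := hI.
have mulI x s : I (x * x) -> I (x * s * (x * s)).
  by move=> Ix; rewrite mulrACA; apply: ideal_mulr.
have iP : is_ideal [set x | I (x * x)].
  split=> [|x y /= Ix Iy|s x /= Ix].
  - by exists 0; rewrite /= mul0r; apply: ideal0.
  (* If [y = x * c], then [x + y = x * (1 + c)], whose square is a multiple of [x * x]. *)
  - case: (valuation_dvd_total x y) => -[c E].
    + by rewrite E -[x in x + _]mulr1 -mulrDr; apply: mulI.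
    + by rewrite E -[y in _ + y]mulr1 -mulrDr; apply: mulI.
  - by rewrite mulrC [s * x]mulrC; apply: mulI.
split; first by apply/(proper_idealP iP); rewrite /= mulr1; apply/(proper_idealP iI).
(* Splitting the fourth power as [x], [x], [x * x] puts the square or the cube of [x] in [I]; the
   cube again yields the square. *)
have pow4 x : I (x * x * (x * x)) -> I (x * x).
  by case/hA => //; rewrite ?mulrA; apply: two_absorbing_sqr.
move=> a b /=; rewrite mulrACA => h.
(* If [b = a * c], the fourth power of [b] is [a * a * (b * b)] times [c * c], hence in [I]. *)
case: (valuation_dvd_total a b) => -[c E]; [right|left]; apply: pow4.
- by rewrite {1 2}E [a * c * _]mulrACA [_ * (b * b)]mulrAC; apply: ideal_mulr.
- by rewrite {3 4}E [b * c * _]mulrACA [a * a * _]mulrA; apply: ideal_mulr.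
Qed.

End Ideals.

Theorem theorem4p10 (S : comNzSemiRingType)
    (hsub : subtractive_semiring S) (hval : valuation_semiring S) :
  two_AB_semiring S <->
  (forall p : set S, prime_ideal p -> ideal_mul p p = p).
Proof.
split=> [hAB p hp | hsq I hI].
  have [[ip _] _] := hp.
  have [_ hp2] := hAB _ (prime_sqr_two_absorbing hval hp).
  apply/seteqP; split=> x.
    by case/(ideal_mul_single hval _ ip ip)=> a [b [pa _ ->]]; apply: ideal_mulr.
  by move=> px; case: (hp2 x x (ideal_mul_prod px px)).
have hP := two_absorbing_radical_prime hval hI.
have [[iI _] _] := hI; have [[iP _] _] := hP.
suff -> : I = [set x | I (x * x)] by [].
apply/seteqP; split=> x; first by move=> Ix; apply: ideal_mulr.
rewrite -{1}(hsq _ hP) => /(ideal_mul_single hval _ iP iP)[a [b [/= Ia Ib ->]]].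
(* By divisibility, [a * b] is a multiple of [a * a] or of [b * b], both in [I]. *)
case: (valuation_dvd_total hval a b) => -[c ->].
- by rewrite mulrA; apply: ideal_mulr.
- by rewrite mulrAC; apply: ideal_mulr.
Qed.
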